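(* Let $n\ge1$, $k\ge2$, $\epsilon_1\in\{1,-1\}$, and let $P(\lambda)=\sum_{j=0}^k\lambda^jA_j$, $A_j\in\mathbb{C}^{n\times n}$, be an $(H,\epsilon_1,1)$-structured matrix polynomial (i.e. $A_j^H=\epsilon_1A_j$ for even $j$ and $A_j^H=A_j$ for odd $j$) with $A_k$ nonsingular, all of whose eigenvalues are semi-simple. Let $(X,J)\in\mathbb{C}^{n\times kn}\times\mathbb{C}^{kn\times kn}$ be a standard pair of $P(\lambda)$ with $X=[X_1,\ldots,X_s]$, $J=\mathrm{diag}(J_1,\ldots,J_s)$, where the spectra of the $J_j$ are pairwise disjoint and: if $\epsilon_1=1$, $J_j=\mathrm{diag}(\lambda_jI_{n_j},\bar\lambda_jI_{n_j})$ with $\lambda_j\in\mathbb{C}\setminus\mathbb{R}$ for $j=1,\ldots,r$, and $J_j=\lambda_jI_{n_j}$ with $\lambda_j\in\mathbb{R}$ for $j=r+1,\ldots,s$; if $\epsilon_1=-1$, $J_j=\mathrm{diag}(\lambda_jI_{n_j},-\bar\lambda_jI_{n_j})$ with $\lambda_j\in\mathbb{C}\setminus\mathrm{i}\mathbb{R}$ for $j=1,\ldots,r$, and $J_j=\lambda_jI_{n_j}$ with $\lambda_j\in\mathrm{i}\mathbb{R}$ for $j=r+1,\ldots,s$. Then there exists a standard pair $(\tilde X,J)$ of $P(\lambda)$ such that the corresponding matrix $\tilde\Gamma\in\mathcal{S}_{(J,H,\epsilon_1,1)}$ has the structure $$\tilde\Gamma=\mathrm{diag}\left(\begin{bmatrix}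 0 & I_{n_1} \\ I_{n_1} & 0 \end{bmatrix},\cdots,\begin{bmatrix} 0 & I_{n_r} \\ I_{n_r} & 0 \end{bmatrix},E_{n_{r+1}},\cdots,E_{n_s}\right),$$ where $E_{n_j}=\mathrm{diag}(\pm1,\ldots,\pm1)$ is $n_j\times n_j$, $j=r+1,\ldots,s$.
   Context: $(X,J)$ is a standard pair of $P$ if the matrix $X_L$ obtained by stacking $X,XJ,\ldots,XJ^{k-1}$ (top to bottom) is nonsingular and $\sum_{i=0}^kA_iXJ^i=0$. An eigenvalue is semi-simple if its algebraic and geometric multiplicities coincide. $\mathrm{i}\mathbb{R}$ is the set of purely imaginary numbers (including $0$). $\mathcal{S}_{(J,H,\epsilon_1,1)}=\{S\in\mathbb{C}^{kn\times kn}:S^H=S,\ SJ^H=\epsilon_1JS\}$. The matrix corresponding to a standard pair $(X,J)$ of $P$ is $\Gamma=(X_L^H\mathcal{A}X_L)^{-1}$, where $\mathcal{A}\in\mathbb{C}^{kn\times kn}$ is the $k\times k$ block matrix whose $(p,q)$ block is $\epsilon_1^{\,p-1}A_{p+q-1}$ if $p+q\le k+1$ and $0$ otherwise. *)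

(* Defs.v *)
From HB Require Import structures.
From mathcomp Require Import all_boot all_order all_algebra.
From mathcomp Require Import complex reals.

Set Implicit Arguments.
Unset Strict Implicit.
Unset Printing Implicit Defensive.

Import Order.TTheory GRing.Theory Num.Theory.
Local Open Scope ring_scope.
Local Open Scope sesquilinear_scope.

Section MatrixPolynomials.
Variable C : numClosedFieldType.

(* The coefficient A_j of lambda^j is [A j], for j in 'I_k.+1. *)
Definition matpoly n k (A : 'I_k.+1 -> 'M[C]_n) : 'M[{poly C}]_n :=
  \sum_(j < k.+1) 'X^j *: map_mx polyC (A j).

Definition matpoly_at n (P : 'M[{poly C}]_n) (x : C) : 'M[C]_n :=
  map_mx (fun p => p.[x]) P.

(* Finite eigenvalues only; there is no eigenvalue at infinity when the
   leading coefficient is nonsingular. *)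
Definition matpoly_eigenvalue n (P : 'M[{poly C}]_n) (x : C) : Prop :=
  exists2 v : 'cV[C]_n, v != 0 & matpoly_at P x *m v = 0.

Definition alg_mult n (P : 'M[{poly C}]_n) (x : C) : nat := mup x (\det P).

(* The column space of [cokermx M] is {v | M *m v = 0}. *)
Definition geom_mult n (P : 'M[{poly C}]_n) (x : C) : nat :=
  \rank (cokermx (matpoly_at P x)).

Definition all_semisimple n (P : 'M[{poly C}]_n) : Prop :=
  forall x, matpoly_eigenvalue P x -> alg_mult P x = geom_mult P x.

Definition structured n k (eps : C) (A : 'I_k.+1 -> 'M[C]_n) : Prop :=
  forall j : 'I_k.+1, (A j)^t* = if odd j then A j else eps *: A j.

(* [\mxcol] and [\mxblock] of k blocks of size n have dimension
   \sum_(i < k) n, which is cast to k * n. *)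
Lemma sum_block_dim (k n : nat) : (\sum_(i < k) n = k * n)%N.
Proof. by rewrite sum_nat_const card_ord. Qed.

Definition stack n k (X : 'M[C]_(n, k * n)) (J : 'M[C]_(k * n)) :
    'M[C]_(k * n) :=
  castmx (sum_block_dim k n, erefl) (\mxcol_(i < k) (X *m J ^+ i)).

Definition standard_pair n k (A : 'I_k.+1 -> 'M[C]_n)
    (X : 'M[C]_(n, k * n)) (J : 'M[C]_(k * n)) : Prop :=
  stack X J \in unitmx /\ \sum_(i < k.+1) A i *m X *m J ^+ i = 0.

(* With p and q counted from 0, the (p, q) block is eps^p A_(p+q+1)
   if p + q + 1 <= k, and 0 otherwise. *)
Definition calA n k (eps : C) (A : 'I_k.+1 -> 'M[C]_n) : 'M[C]_(k * n) :=
  castmx (sum_block_dim k n, sum_block_dim k n)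
    (\mxblock_(p < k, q < k)
       if ((p + q).+1 <= k)%N then eps ^+ p *: A (inord (p + q).+1) else 0).

Definition Gamma n k (eps : C) (A : 'I_k.+1 -> 'M[C]_n)
    (X : 'M[C]_(n, k * n)) (J : 'M[C]_(k * n)) : 'M[C]_(k * n) :=
  invmx ((stack X J)^t* *m calA eps A *m stack X J).

Definition in_S N (J : 'M[C]_N) (eps : C) (S : 'M[C]_N) : Prop :=
  S^t* = S /\ S *m J^t* = eps *: (J *m S).

(* The fixed locus of the eigenvalue symmetry: the real line for eps = 1, the
   imaginary line (0 included) for eps = -1. *)
Definition symm_line (eps : C) : {pred C} :=
  fun z => if eps == 1 then z \is Num.real else 'Re z == 0.

Definition mate (eps z : C) : C := if eps == 1 then z^* else - z^*.

(* [b] tells whether the block belongs to a pair {z, mate z} of eigenvalues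
   off the line (size 2m) or to a single eigenvalue on it (size m). *)
Definition block_dim (b : bool) (m : nat) : nat := if b then (m + m)%N else m.

Definition J_block (eps : C) (b : bool) (m : nat) (z : C) :
    'M[C]_(block_dim b m) :=
  match b return 'M[C]_(block_dim b m) with
  | true => block_mx z%:M 0 0 (mate eps z)%:M
  | false => z%:M
  end.

(* [e] holds the diagonal of the block when [b] is false, and is unused
   otherwise. *)
Definition Gamma_block (b : bool) (m : nat) (e : 'rV[C]_m) :
    'M[C]_(block_dim b m) :=
  match b return 'M[C]_(block_dim b m) with
  | true => block_mx 0 1%:M 1%:M 0
  | false => diag_mx e
  end.

End MatrixPolynomials.

(* Main.v *)
(** The matrix M = X_L^H calA X_L is Hermitian and nonsingular and satisfies
    J^H M = eps M J, so the eigenspaces of J for x and y are M-orthogonal unless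
    y = mate x. Since J is diagonal and the spectra of its blocks are disjoint
    and closed under mate, M is block diagonal along J. Replacing X by X T with
    T commuting with J replaces Gamma^-1 = M by T^H M T, so it remains to
    reduce each block of M by congruence with a T commuting with the block
    of J: on a pair block M = [0 B; B^H 0] and T = diag(I, B^-1) works; on a
    single eigenvalue any T commutes and the spectral theorem reduces M to signs.
    The resulting form is an involution, hence equals Gamma itself. *)

Require Import Defs.
From HB Require Import structures.
From mathcomp Require Import all_boot all_order all_algebra.
From mathcomp Require Import complex reals zify.

Set Implicit Arguments.
Unset Strict Implicit.
Unset Printing Implicit Defensive.

Import Order.TTheory GRing.Theory Num.Theory.
Local Open Scope ring_scope.
Local Open Scope sesquilinear_scope.

(** * Algebra of the conjugate transpose *)

Section ConjugateTranspose.
Variable C : numClosedFieldType.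

Lemma adjmxM m n p (A : 'M[C]_(m, n)) (B : 'M_(n, p)) :
  (A *m B)^t* = B^t* *m A^t*.
Proof. by rewrite trmx_mul map_mxM. Qed.

Lemma adjmxZ m n (a : C) (A : 'M[C]_(m, n)) : (a *: A)^t* = a^* *: A^t*.
Proof. by rewrite linearZ /= map_mxZ. Qed.

Lemma adjmx_scalar n (a : C) : (a%:M : 'M_n)^t* = (a^*)%:M.
Proof. by rewrite tr_scalar_mx map_scalar_mx. Qed.

Lemma adjmx_diag n (d : 'rV[C]_n) : (diag_mx d)^t* = diag_mx (map_mx Num.conj d).
Proof. by rewrite tr_diag_mx map_diag_mx. Qed.

Lemma adjmx_inv n (A : 'M[C]_n) : (invmx A)^t* = invmx (A^t*).
Proof. by rewrite trmx_inv map_invmx. Qed.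

Lemma unitmx_adj n (A : 'M[C]_n) : (A^t* \in unitmx) = (A \in unitmx).
Proof. by rewrite map_unitmx unitmx_tr. Qed.

Lemma adjmx0 m n : (0 : 'M[C]_(m, n))^t* = 0.
Proof. by rewrite trmx0 map_mx0. Qed.

Lemma adjmx_sum m n (I : Type) (r : seq I) (P : pred I)
    (F : I -> 'M[C]_(m, n)) :
  (\sum_(i <- r | P i) F i)^t* = \sum_(i <- r | P i) (F i)^t*.
Proof. by rewrite raddf_sum /= map_mx_sum. Qed.

End ConjugateTranspose.

(** * Products and units under a change of dimension *)

Section Castmx.
Variable C : numClosedFieldType.

Lemma castmx_gram m m' n (e : m = m') (U : 'M[C]_(m, n)) (V : 'M[C]_m) :
  (castmx (e, erefl) U)^t* *m castmx (e, e) V *m castmx (e, erefl) U =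
  U^t* *m V *m U.
Proof. by case: m' / e. Qed.

Lemma castmx_mul_rows m m' n p (e : m = m') (U : 'M[C]_(m, n))
    (V : 'M[C]_(n, p)) :
  castmx (e, erefl) U *m V = castmx (e, erefl) (U *m V).
Proof. by case: m' / e. Qed.

Lemma unitmx_castmx m m' (e : m = m') (A : 'M[C]_m) :
  (castmx (e, e) A \in unitmx) = (A \in unitmx).
Proof. by case: m' / e. Qed.

End Castmx.

(** * The Gram matrix X_L^H calA X_L of a standard pair *)

Section StandardPair.
Variables (C : numClosedFieldType) (n k : nat) (eps : C).
Variable A : 'I_k.+1 -> 'M[C]_n.

Lemma calA_unit : eps != 0 -> A ord_max \in unitmx -> calA eps A \in unitmx.
Proof.
move=> eps0 Ak; rewrite unitmx_castmx -row_free_unit -kermx_eq0.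
apply/rowV0P => u /sub_kermxP; rewrite -[u]submxrowK => uA0.
(* calA is block anti-triangular: column k - 1 - p isolates block p of u. *)
suff u0 p : submxrow u p = 0 by rewrite (eq_mxrow u0) mxrow0.
have [m] := ubnP (p : nat); elim: m p => // m IHm p /ltnSE le_pm.
have ltk : (k.-1 - p < k)%N by have := ltn_ord p; lia.
have := congr1 (fun B => submxrow B (Ordinal ltk)) uA0.
(* Blocks q < p of u vanish by induction. For q > p the index q + (k - 1 - p) + 1 exceeds k, so the
   block of [calA] is 0. Only u_p eps^p A_k remains. *)
rewrite mul_mxrow_mxblock mxrowK submxrow0 (bigD1 p) //= big1 ?addr0; last first.
  move=> q qp; have [lt_qp|le_pq] := ltnP q p.
    by rewrite IHm ?mul0mx // (leq_trans lt_qp).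
  rewrite ifF ?mulmx0 //; apply/negbTE; rewrite -ltnNge.
  have : (q : nat) != p by [].
  by have := ltn_ord p; lia.
have -> : (p + (k.-1 - p)).+1 = k by have := ltn_ord p; lia.
rewrite leqnn.
have -> : inord k = ord_max :> 'I_k.+1 by apply/val_inj; rewrite /= inordK.
move/(congr1 (mulmx^~ (invmx (eps ^+ p *: A ord_max)))).
by rewrite mul0mx mulmxK // unitmxZ // unitfE expf_neq0.
Qed.

Hypothesis eps2 : eps = 1 \/ eps = -1.

Lemma eps_conj : eps^* = eps.
Proof. by case: eps2 => ->; rewrite ?rmorphN rmorph1. Qed.

Lemma eps_sqr : eps * eps = 1.
Proof. by case: eps2 => ->; rewrite ?mulrNN mulr1. Qed.

Lemma eps_neq0 : eps != 0.
Proof. by case: eps2 => ->; rewrite ?oppr_eq0 oner_eq0. Qed.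

Lemma eps_expE p : eps ^+ p = if odd p then eps else 1.
Proof.
elim: p => [|p IHp] /=; first by rewrite expr0.
by rewrite exprS IHp; case: (odd p); rewrite ?mulr1 // eps_sqr.
Qed.

Hypothesis A_str : structured eps A.

Lemma structuredE j : (A j)^t* = eps ^+ j.+1 *: A j.
Proof. by rewrite A_str eps_expE /=; case: (odd j) => //; rewrite scale1r. Qed.

Variables (X : 'M[C]_(n, k * n)) (J : 'M[C]_(k * n)).
Hypothesis XJ : standard_pair A X J.

Definition gram : 'M[C]_(k * n) := (stack X J)^t* *m calA eps A *m stack X J.

(** The index l is kept apart from p and q: the Gram matrix has l = p + q + 1, the shifted sums in
    [gram_J] have l = p + q. *)
Definition gram_term p q l : 'M[C]_(k * n) :=
  (J ^+ p)^t* *m (eps ^+ p *: (X^t* *m A (inord l) *m X)) *m J ^+ q.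

Lemma gramE : gram = \sum_(p < k) \sum_(q < k)
  if ((p + q).+1 <= k)%N then gram_term p q (p + q).+1 else 0.
Proof.
rewrite /gram castmx_gram.
have -> : (\mxcol_(i < k) (X *m J ^+ i))^t* = \mxrow_(i < k) (X *m J ^+ i)^t*.
  by apply/matrixP => i j; rewrite !mxE.
rewrite mul_mxrow_mxblock mul_mxrow_mxcol exchange_big /=.
apply: eq_bigr => q _; rewrite mulmx_suml; apply: eq_bigr => p _.
case: ifP => _; last by rewrite mulmx0 mul0mx.
by rewrite /gram_term adjmxM -!scalemxAr -!scalemxAl !mulmxA.
Qed.

(** With l = p + q + 1, the sign of the adjoint is eps^p eps^(l+1) = eps^(2p+q+2) = eps^q. *)
Lemma gram_term_adj p q : ((p + q).+1 <= k)%N ->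
  (gram_term p q (p + q).+1)^t* = gram_term q p (p + q).+1.
Proof.
move=> lek; rewrite /gram_term !adjmxM adjmxZ !adjmxM !trmxCK rmorphXn /= eps_conj.
rewrite structuredE inordK // !mulmxA.
rewrite -!scalemxAr -!scalemxAl -!scalemxAr -!scalemxAl scalerA !mulmxA.
congr (_ *: _).
rewrite !eps_expE /= oddD negbK.
by case: (odd p); case: (odd q); rewrite /= ?mul1r ?mulr1 ?eps_sqr.
Qed.

Lemma gram_herm : gram^t* = gram.
Proof.
rewrite gramE adjmx_sum; under eq_bigr do rewrite adjmx_sum.
rewrite exchange_big /=; apply: eq_bigr => p _; apply: eq_bigr => q _.
rewrite [(p + q)%N]addnC; case: ifP => [le_k|_]; last exact: adjmx0.
by rewrite gram_term_adj // [(p + q)%N]addnC.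
Qed.

(** Multiplying by J on the right raises q; multiplying by J^H on the left raises p and costs a
    factor eps. Both sides are thus shifted sums of the same array [U]. *)
Lemma gram_J : J^t* *m gram = eps *: (gram *m J).
Proof.
pose U p q := if (p + q <= k)%N then gram_term p q (p + q) else 0.
have sum0 : \sum_(i < k.+1) A i *m X *m J ^+ i = 0 by case: XJ.
have UE0 : \sum_(q < k.+1) U 0 q = 0.
  transitivity (X^t* *m \sum_(i < k.+1) A i *m X *m J ^+ i); last first.
    by rewrite sum0 mulmx0.
  rewrite mulmx_sumr; apply: eq_bigr => q _.
  rewrite /U /gram_term add0n -ltnS ltn_ord !expr0 scale1r inord_val.
  by rewrite adjmx_scalar rmorph1 mul1mx !mulmxA.
(* Column 0 is eps times the adjoint of the equation of the pair, times X, because eps A_p^H = eps^p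
   A_p. *)
have U0E : \sum_(p < k.+1) U p 0 = 0.
  transitivity (eps *: ((\sum_(i < k.+1) A i *m X *m J ^+ i)^t* *m X));
    last by rewrite sum0 adjmx0 mul0mx scaler0.
  rewrite adjmx_sum mulmx_suml scaler_sumr; apply: eq_bigr => p _.
  rewrite /U /gram_term addn0 -ltnS ltn_ord expr0 mulmx1 inord_val.
  rewrite !adjmxM structuredE -!scalemxAr -!scalemxAl scalerA.
  by rewrite exprS mulrA eps_sqr mul1r !mulmxA.
(* The added row p = k is zero, since k + q + 1 > k; so is the added column q = k in [Jg]. *)
have gJ : gram *m J = \sum_(p < k.+1) \sum_(q < k) U p q.+1.
  rewrite gramE mulmx_suml big_ord_recr /= [X in _ = _ + X]big1 ?addr0.
    apply: eq_bigr => p _; rewrite mulmx_suml; apply: eq_bigr => q _.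
    rewrite /U /gram_term addnS; case: ifP => _; last by rewrite mul0mx.
    by rewrite exprSr !mulmxA.
  by move=> q _; rewrite /U ifF //; apply/negbTE; lia.
have Jg : J^t* *m gram = eps *: \sum_(p < k) \sum_(q < k.+1) U p.+1 q.
  rewrite gramE mulmx_sumr scaler_sumr; apply: eq_bigr => p _.
  rewrite big_ord_recr /= {2}/U ifF ?addr0; last by apply/negbTE; lia.
  rewrite mulmx_sumr scaler_sumr; apply: eq_bigr => q _.
  rewrite /U /gram_term addSn; case: ifP => _; last by rewrite mulmx0 scaler0.
  rewrite exprSr adjmxM !mulmxA -!scalemxAr -!scalemxAl scalerA.
  by rewrite exprS mulrA eps_sqr mul1r !mulmxA.
rewrite Jg gJ; congr (_ *: _).
(* Both sides are the full sum of U, as its row 0 and column 0 sum to 0. *)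
transitivity (\sum_(p < k.+1) \sum_(q < k.+1) U p q).
  by rewrite [RHS]big_ord_recl UE0 add0r.
under eq_bigr => p _ do rewrite big_ord_recl.
by rewrite big_split /= U0E add0r.
Qed.

Lemma gram_unit : A ord_max \in unitmx -> gram \in unitmx.
Proof.
case: XJ => XJu _ Ak.
by rewrite /gram !unitmx_mul unitmx_adj XJu calA_unit // eps_neq0.
Qed.

Lemma Gamma_in_S : A ord_max \in unitmx -> in_S J eps (Gamma eps A X J).
Proof.
move=> /gram_unit gU; rewrite /in_S -[Gamma _ _ _ _]/(invmx gram).
split; first by rewrite adjmx_inv gram_herm.
apply: (can_inj (mulmxK gU)); rewrite -mulmxA gram_J -scalemxAr mulKmx //.
by rewrite -scalemxAl mulmxKV.
Qed.

Variable T : 'M[C]_(k * n).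
Hypothesis TJ : T *m J = J *m T.

Lemma stack_mul_comm : stack (X *m T) J = stack X J *m T.
Proof.
rewrite castmx_mul_rows mxcol_mul; congr castmx; apply: eq_mxcol => i.
rewrite -!mulmxA; congr (_ *m _); exact: commrX.
Qed.

Lemma standard_pair_mul_comm : T \in unitmx -> standard_pair A (X *m T) J.
Proof.
case: XJ => XJu sum0 Tu; split.
  by rewrite stack_mul_comm unitmx_mul XJu.
transitivity ((\sum_(i < k.+1) A i *m X *m J ^+ i) *m T).
  rewrite mulmx_suml; apply: eq_bigr => i _; rewrite -!mulmxA.
  by do 2!congr (_ *m _); exact: commrX.
by rewrite sum0 mul0mx.
Qed.

Lemma Gamma_mul_comm : Gamma eps A (X *m T) J = invmx (T^t* *m gram *m T).
Proof. by rewrite /Gamma stack_mul_comm adjmxM /gram !mulmxA. Qed.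

End StandardPair.

(** * Block diagonal matrices *)

Section BlockDiagonal.
Variables (C : numClosedFieldType) (s : nat) (p_ : 'I_s -> nat).

Lemma mxblock_mxdiag (B : forall i j : 'I_s, 'M[C]_(p_ i, p_ j)) :
  (forall i j, i != j -> B i j = 0) ->
  \mxblock_(i, j) B i j = \mxdiag_i B i i.
Proof.
move=> B0; apply: eq_mxblock => i j; case: eqVneq => [<-|ij]; last exact: B0.
by rewrite conform_mx_id.
Qed.

Lemma mul_mxdiag (D E : forall i : 'I_s, 'M[C]_(p_ i)) :
  (\mxdiag_i D i) *m (\mxdiag_i E i) = \mxdiag_i (D i *m E i).
Proof.
rewrite mul_mxblock_mxdiag; apply: eq_mxblock => i j.
case: eqVneq => [<-|_]; last by rewrite mul0mx.
by rewrite !conform_mx_id.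
Qed.

Lemma adjmx_mxdiag (D : forall i : 'I_s, 'M[C]_(p_ i)) :
  (\mxdiag_i D i)^t* = \mxdiag_i (D i)^t*.
Proof.
rewrite tr_mxdiag; apply/mxblockP => i j; rewrite mxblockK.
have -> B : submxblock (map_mx Num.conj B) i j =
    map_mx Num.conj (submxblock B i j) :> 'M[C]_(p_ i, p_ j).
  by apply/matrixP => x y; rewrite !mxE.
rewrite mxblockK; case: eqVneq => [<-|_]; last exact: map_mx0.
by rewrite !conform_mx_id.
Qed.

(** The (i, i) block of the inverse of the whole matrix is a right inverse of [D i]. *)
Lemma mxdiag_unit (D : forall i : 'I_s, 'M[C]_(p_ i)) :
  \mxdiag_i D i \in unitmx -> forall i, D i \in unitmx.
Proof.
move=> /mulmxV; rewrite -[invmx _]submxblockK mul_mxdiag_mxblock => + i.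
move/(congr1 (fun M => submxblock M i i)); rewrite mxblockK -mxdiagZ.
by rewrite submxblock_diag => /mulmx1_unit[].
Qed.

End BlockDiagonal.

(** * Reduction of a single block by congruence *)

Section CanonicalBlocks.
Variable C : numClosedFieldType.

Lemma hermitian_congr_sign m (D : 'M[C]_m) : D^t* = D -> D \in unitmx ->
  exists (T : 'M[C]_m), exists2 e : 'rV[C]_m,
    forall l, e 0 l = 1 \/ e 0 l = -1 & T^t* *m D *m T = diag_mx e.
Proof.
move=> Dherm Du.
have Dh : D \is hermsymmx.
  by apply/is_hermitianmxP; rewrite expr0 scale1r Dherm.
have /orthomx_spectralP DE := hermitian_normalmx Dh.
have /mxOverP d_real := hermitian_spectral_diag_real Dh.
have Pu := spectral_unit D.
have Pinv := invmx_unitary (spectral_unitarymx D).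
move: (spectralmx D) (spectral_diag D) DE d_real Pu Pinv => P d DE d_real Pu Pinv.
have d0 l : d 0 l != 0.
  move: Du; rewrite DE !unitmx_mul => /andP[/andP[_ du] _].
  move: du; rewrite unitmxE det_diag unitfE => /prodf_neq0; exact.
have nd0 l : `|d 0 l| != 0 by rewrite normr_eq0.
(* With D = P^-1 diag(d) P and P unitary, T = P^-1 diag(c) turns each eigenvalue d into d c^2 = d /
   |d|, which is a sign because d is real and nonzero. *)
pose c := \row_l (sqrtC `|d 0 l|)^-1.
have c_real l : (c 0 l)^* = c 0 l.
  by rewrite mxE; apply/CrealP; rewrite rpredV ger0_real // sqrtC_ge0.
exists (invmx P *m diag_mx c), (\row_l (d 0 l / `|d 0 l|)) => [l|].
  have : (d 0 l / `|d 0 l|) ^+ 2 == 1.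
    by rewrite expr_div_n real_normK ?divff // ?expf_neq0 // d_real.
  by rewrite mxE sqrf_eq1 => /orP[] /eqP ->; [left | right].
have cE : map_mx Num.conj c = c by apply/rowP => l; rewrite mxE c_real.
have PP : P *m P^t* = 1%:M by rewrite -Pinv mulmxV.
rewrite adjmxM adjmx_diag cE DE Pinv trmxCK.
transitivity (diag_mx c *m (P *m P^t*) *m diag_mx d *m (P *m P^t*) *m diag_mx c).
  by rewrite !mulmxA.
rewrite PP !mulmx1 !mulmx_diag.
congr diag_mx; apply/rowP => l; rewrite !mxE mulrAC -invfM -expr2 sqrtCK.
by rewrite mulrC.
Qed.

Lemma scalemx_eq0_neq m p (x y : C) (M : 'M[C]_(m, p)) :
  x != y -> x *: M = y *: M -> M = 0.
Proof.
move=> xy /eqP; rewrite -subr_eq0 -scalerBl scaler_eq0 subr_eq0 (negbTE xy).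
by move=> /eqP.
Qed.

Variable eps : C.
Hypothesis eps2 : eps = 1 \/ eps = -1.

Lemma symm_lineE z : (z \in symm_line eps) = (mate eps z == z).
Proof.
rewrite /symm_line /mate unfold_in; case: eqP => _; first by rewrite CrealE.
rewrite ReE mulf_eq0 invr_eq0 (negbTE (_ : 2 != 0)) ?pnatr_eq0 // orbF.
by rewrite addr_eq0 eq_sym.
Qed.

(** A formula uniform in eps: later computations need only that eps is real with square 1. *)
Lemma mateE z : mate eps z = eps * z^*.
Proof.
rewrite /mate; case: eps2 => ->; first by rewrite eqxx mul1r.
by rewrite eqNr oner_eq0 mulN1r.
Qed.

Lemma mateK : involutive (mate eps).
Proof.
move=> z; rewrite !mateE rmorphM /= conjCK eps_conj // mulrA eps_sqr //.
exact: mul1r.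
Qed.

(** Having the diagonal as a row over [block_dim b m] lets one entrywise argument treat both kinds
    of blocks. *)
Definition J_diag (b : bool) (m : nat) (z : C) : 'rV[C]_(block_dim b m) :=
  match b return 'rV[C]_(block_dim b m) with
  | true => row_mx (const_mx z) (const_mx (mate eps z))
  | false => const_mx z
  end.

Lemma J_blockE b m z : J_block eps b m z = diag_mx (J_diag b m z).
Proof.
case: b => /=; last by rewrite diag_const_mx.
by rewrite diag_mx_row !diag_const_mx.
Qed.

Lemma eigenvalue_diag_mx m (d : 'rV[C]_m) i : eigenvalue (diag_mx d) (d 0 i).
Proof.
apply/eigenvalueP; exists (delta_mx 0 i).
  apply/rowP => j; rewrite -rowE !mxE eqxx /=.
  by rewrite [i == j]eq_sym; case: (j == i); rewrite ?mulr1 ?mulr0.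
by apply/negP => /eqP/rowP/(_ i)/eqP; rewrite !mxE !eqxx oner_eq0.
Qed.

(** In a pair block [mate] swaps the two halves of the diagonal; on the line every entry is its own
    mate. *)
Lemma J_diag_mate b m z i : (~~ b -> z \in symm_line eps) ->
  exists j, J_diag b m z 0 j = mate eps (J_diag b m z 0 i).
Proof.
case: b i => /= i z_line; last first.
  by exists i; rewrite !mxE; apply/esym/eqP; rewrite -symm_lineE z_line.
case: (split_ordP i) => j ij; rewrite {i}ij.
  by exists (rshift m j); rewrite row_mxEr row_mxEl !mxE.
by exists (lshift m j); rewrite row_mxEr row_mxEl !mxE mateK.
Qed.

(** For diagonal entries x_i and y_j of the two blocks, the relation reads conj(x_i) M_ij = eps M_ij
    y_j. If M_ij is nonzero then y_j = mate x_i, an eigenvalue common to both blocks. *)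
Lemma J_block_orthogonal b1 m1 z1 b2 m2 z2 (M : 'M[C]_(_, _)) :
    (~~ b1 -> z1 \in symm_line eps) ->
    (forall x, ~~ (eigenvalue (J_block eps b1 m1 z1) x &&
                   eigenvalue (J_block eps b2 m2 z2) x)) ->
    (J_block eps b1 m1 z1)^t* *m M = eps *: (M *m J_block eps b2 m2 z2) ->
  M = 0.
Proof.
rewrite !J_blockE adjmx_diag => z1_line disj JM.
apply/matrixP => i j; rewrite [RHS]mxE; apply/eqP/negPn/negP => Mij0.
have [l Jl] := J_diag_mate i z1_line.
have /negP := disj (mate eps (J_diag b1 m1 z1 0 i)); apply.
rewrite -{1}Jl eigenvalue_diag_mx /=.
suff -> : mate eps (J_diag b1 m1 z1 0 i) = J_diag b2 m2 z2 0 j.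
  exact: eigenvalue_diag_mx.
have /matrixP/(_ i j) := JM.
rewrite mul_diag_mx mul_mx_diag !mxE => /(congr1 ( *%R eps)).
rewrite mulrA -mateE mulrA eps_sqr // mul1r mulrC => /(mulfI Mij0) ->.
by [].
Qed.

Lemma J_block_canonical b m z (D : 'M[C]_(block_dim b m)) :
    (b -> z \notin symm_line eps) ->
    D^t* = D -> D \in unitmx ->
    (J_block eps b m z)^t* *m D = eps *: (D *m J_block eps b m z) ->
  exists (T : 'M[C]_(block_dim b m)) (e : 'rV[C]_m),
    [/\ T *m J_block eps b m z = J_block eps b m z *m T,
        ~~ b -> forall l, e 0 l = 1 \/ e 0 l = -1 &
        T^t* *m D *m T = Gamma_block b e].
Proof.
case: b D => /= D z_line Dherm Du JD; last first.
  have [T [e e1 TD]] := hermitian_congr_sign Dherm Du.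
  by exists T, e; split => //; exact: scalar_mxC.
move/(_ isT): z_line; rewrite symm_lineE => z_line.
move: (ulsubmx D) (ursubmx D) (dlsubmx D) (drsubmx D) (submxK D) => a b c d DE.
move: JD; rewrite -DE tr_block_mx map_block_mx !trmx0 !map_mx0 !adjmx_scalar.
rewrite !mulmx_block !(mul0mx, mulmx0, addr0, add0r) scale_block_mx.
rewrite !mul_scalar_mx !mul_mx_scalar !scalerA => /eq_block_mx[Ea _ _ Ed].
(* The relation gives (mate z) a = z a, and likewise for d, while mate z differs from z off the
   line. *)
have a0 : a = 0.
  apply: (scalemx_eq0_neq z_line); rewrite mateE -scalerA Ea !scalerA.
  by rewrite mulrA eps_sqr // mul1r.
have d0 : d = 0.
  apply: (@scalemx_eq0_neq _ _ z (mate eps z)); first by rewrite eq_sym.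
  have := congr1 ( *:%R eps) Ed.
  by rewrite !scalerA mulrA eps_sqr // {1}mateE rmorphM /= conjCK eps_conj //
    mulrA eps_sqr // !mul1r.
move: Dherm; rewrite -DE a0 d0 tr_block_mx map_block_mx => /eq_block_mx[_ _ Ec _].
(* Now D = [0 b; c 0], so the upper left block of D D^-1 = 1 exhibits a right inverse of b. *)
have bu : b \in unitmx.
  have := mulmxV Du; rewrite -[invmx D]submxK -{1}DE a0 d0 mulmx_block.
  rewrite (@scalar_mx_block _ m m) => /eq_block_mx[+ _ _ _].
  by rewrite mul0mx add0r => /mulmx1_unit[].
(* The sign vector is constrained only when [b] is false; 0 is a placeholder. *)
exists (block_mx 1%:M 0 0 (invmx b)), (const_mx 0); split => //.
  rewrite !mulmx_block !(mul0mx, mulmx0, addr0, add0r, mul1mx, mulmx1).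
  by rewrite scalar_mxC.
rewrite tr_block_mx map_block_mx !trmx0 !map_mx0 adjmx_scalar rmorph1 -Ec.
rewrite !mulmx_block !(mul0mx, mulmx0, addr0, add0r, mul1mx, mulmx1).
by rewrite mulmxV // -adjmxM mulmxV // adjmx_scalar conjC1.
Qed.

Lemma Gamma_block_invol b m (e : 'rV[C]_m) :
    (~~ b -> forall l, e 0 l = 1 \/ e 0 l = -1) ->
  Gamma_block b e *m Gamma_block b e = 1%:M.
Proof.
case: b => /= e1.
  by rewrite mulmx_block !(mul0mx, mulmx0, mulmx1, addr0, add0r) -scalar_mx_block.
rewrite mulmx_diag -diag_const_mx; congr diag_mx; apply/rowP => l.
by rewrite !mxE; case: (e1 isT l) => ->; rewrite ?mulrNN mulr1.
Qed.

End CanonicalBlocks.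

(** * Assembling the block reductions *)

Section CanonicalCongruence.
Variables (C : numClosedFieldType) (eps : C) (s r : nat) (n_ : 'I_s -> nat).
Variable lam : 'I_s -> C.
Hypothesis eps2 : eps = 1 \/ eps = -1.
Let p_ (j : 'I_s) := block_dim (j < r)%N (n_ j).
Let Jb (j : 'I_s) : 'M[C]_(p_ j) := J_block eps (j < r)%N (n_ j) (lam j).
Hypothesis disj : forall i j : 'I_s, i != j -> forall x : C,
  ~~ (eigenvalue (Jb i) x && eigenvalue (Jb j) x).
Hypothesis pairs : forall j : 'I_s, (j < r)%N -> lam j \notin symm_line eps.
Hypothesis singles : forall j : 'I_s, (r <= j)%N -> lam j \in symm_line eps.

(** The dimension N is a variable so that case analysis on [e] removes the casts, which the fixed
    expression k * n would prevent. *)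
Lemma canonical_congruence N (e : (\sum_(j < s) p_ j = N)%N) (M J : 'M[C]_N) :
    J = castmx (e, e) (\mxdiag_j Jb j) ->
    M^t* = M -> M \in unitmx -> J^t* *m M = eps *: (M *m J) ->
  exists (T : 'M[C]_N) (d : forall j : 'I_s, 'rV[C]_(n_ j)),
    [/\ T \in unitmx, T *m J = J *m T,
        forall j : 'I_s, (r <= j)%N -> forall l, d j 0 l = 1 \/ d j 0 l = -1 &
        invmx (T^t* *m M *m T) =
          castmx (e, e) (\mxdiag_(j < s) Gamma_block (j < r)%N (d j))].
Proof.
case: N / e M J => M J; rewrite !castmx_id => -> Mherm Mu JM.
have sing (j : 'I_s) : ~~ (j < r)%N -> lam j \in symm_line eps.
  by rewrite -leqNgt; exact: singles.
have Bherm j : (submxblock M j j)^t* = submxblock M j j.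
  by rewrite -{2}Mherm; apply/matrixP => x y; rewrite !mxE.
have JB i j : (Jb i)^t* *m submxblock M i j = eps *: (submxblock M i j *m Jb j).
  move: JM; rewrite adjmx_mxdiag -{1 2}[M]submxblockK mul_mxdiag_mxblock.
  rewrite mul_mxblock_mxdiag => /(congr1 (fun M => submxblock M i j)).
  rewrite mxblockK => ->; rewrite -[in RHS](mxblockK (fun i j => _ i j *m _)).
  by apply/matrixP => x y; rewrite !mxE.
have ME : M = \mxdiag_j submxblock M j j.
  rewrite -{1}[M]submxblockK; apply: mxblock_mxdiag => i j ij.
  exact: (J_block_orthogonal eps2 (sing i) (disj ij) (JB i j)).
have Bu j : submxblock M j j \in unitmx.
  by move: j; apply: mxdiag_unit; rewrite -ME.
have /fin_all_exists [T /fin_all_exists [d TdP]] := fun j : 'I_s =>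
  J_block_canonical eps2 (@pairs j) (Bherm j) (Bu j) (JB j j).
have d1 (j : 'I_s) : ~~ (j < r)%N -> forall l, d j 0 l = 1 \/ d j 0 l = -1.
  by have [] := TdP j.
pose G := \mxdiag_(j < s) Gamma_block (j < r)%N (d j).
have GG : G *m G = 1%:M.
  rewrite mul_mxdiag -mxdiagZ; apply: eq_mxdiag => j.
  exact: Gamma_block_invol (d1 j).
have TMT : (\mxdiag_j T j)^t* *m M *m (\mxdiag_j T j) = G.
  rewrite ME adjmx_mxdiag !mul_mxdiag; apply: eq_mxdiag => j.
  by have [] := TdP j.
have [Gu _] := mulmx1_unit GG.
exists (\mxdiag_j T j), d; split.
(* T is a factor of the invertible matrix G = T^H M T. *)
- by move: Gu; rewrite -TMT !unitmx_mul => /andP[].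
- by rewrite !mul_mxdiag; apply: eq_mxdiag => j; have [] := TdP j.
- by move=> j; rewrite leqNgt => /d1.
- by rewrite TMT castmx_id -[invmx G]mulmx1 -GG mulKmx.
Qed.

End CanonicalCongruence.

(** * The canonical form of Gamma *)

Theorem theorem3p10 (R : realType) (n k : nat) (eps : R[i])
  (A : 'I_k.+1 -> 'M[R[i]]_n)
  (s r : nat) (n_ : 'I_s -> nat) (lam : 'I_s -> R[i])
  (hdim : (\sum_(j < s) block_dim (j < r)%N (n_ j) = k * n)%N)
  (Xb : forall j : 'I_s, 'M[R[i]]_(n, block_dim (j < r)%N (n_ j)))
  (X : 'M[R[i]]_(n, k * n)) (J : 'M[R[i]]_(k * n)) :
  (1 <= n)%N -> (2 <= k)%N -> (r <= s)%N -> (forall j, 0 < n_ j)%N ->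
  eps = 1 \/ eps = -1 ->
  structured eps A ->
  A ord_max \in unitmx ->
  all_semisimple (matpoly A) ->
  standard_pair A X J ->
  X = castmx (erefl n, hdim) (\mxrow_(j < s) Xb j) ->
  J = castmx (hdim, hdim)
        (\mxdiag_(j < s) J_block eps (j < r)%N (n_ j) (lam j)) ->
  (forall i j : 'I_s, i != j -> forall x : R[i],
     ~~ (eigenvalue (J_block eps (i < r)%N (n_ i) (lam i)) x &&
         eigenvalue (J_block eps (j < r)%N (n_ j) (lam j)) x)) ->
  (forall j : 'I_s, (j < r)%N -> lam j \notin symm_line eps) ->
  (forall j : 'I_s, (r <= j)%N -> lam j \in symm_line eps) ->
  exists Xt : 'M[R[i]]_(n, k * n),
    [/\ standard_pair A Xt J,
        in_S J eps (Gamma eps A Xt J) &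
        exists2 e : forall j : 'I_s, 'rV[R[i]]_(n_ j),
          forall j : 'I_s, (r <= j)%N ->
            forall l : 'I_(n_ j), e j 0 l = 1 \/ e j 0 l = -1 &
          Gamma eps A Xt J =
            castmx (hdim, hdim)
              (\mxdiag_(j < s) Gamma_block (j < r)%N (e j))].
Proof.
move=> _ _ _ _ eps2 A_str Ak _ XJ _ JE disj pairs singles.
have [T [d [Tu TJ d1 TMT]]] := canonical_congruence eps2 disj pairs singles JE
  (gram_herm eps2 A_str X J) (gram_unit eps2 XJ Ak) (gram_J eps2 A_str XJ).
have XTJ := standard_pair_mul_comm XJ TJ Tu.
exists (X *m T); split => //; first exact: Gamma_in_S.
by exists d => //; rewrite Gamma_mul_comm.
Qed.
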